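(* Let $f(x)=x e^{-2/x}$ for $x>0$. Then $r:=\lim_{n\to\infty} r_n/n$ exists and satisfies $f(r)=e^{-5}$. Moreover, $r$ is approximately $0.470927$.
   Context: For each integer $n\ge1$ and $i=1,\ldots,n$, let $$\alpha(i)=\alpha_n(i)=\frac{2n}{i}+\sum_{j=i+1}^{n}\frac{1}{j-1}$$ (empty sums are $0$), and let $r_n=\min\{\,1\le i\le n:\ \alpha_n(i)\le 5\,\}$. *)

(* Defs.v *)
From mathcomp Require Import all_boot all_order all_algebra.
From mathcomp Require Import all_classical all_reals all_analysis.

Set Implicit Arguments.
Unset Strict Implicit.
Unset Printing Implicit Defensive.

Import Order.TTheory GRing.Theory Num.Theory.
Import numFieldNormedType.Exports.

Local Open Scope ring_scope.

Definition alpha (R : realType) (n i : nat) : R :=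
  (2 * n)%:R / i%:R + \sum_(i.+1 <= j < n.+1) (j.-1)%:R^-1.

(* The default value n of the minimum is harmless for n >= 1, since then n
   belongs to the set: see [r_seqP]. The value at n = 0 is junk. *)
Definition r_seq (R : realType) (n : nat) : nat :=
  \big[minn/n]_(1 <= i < n.+1 | alpha R n i <= 5) i.

Definition f (R : realType) (x : R) : R := x * expR (- 2 / x).

Lemma alpha_nn (R : realType) (n : nat) : (0 < n)%N -> alpha R n n = 2.
Proof.
move=> n0; rewrite /alpha big_geq // addr0 natrM mulfK //.
by rewrite pnatr_eq0 -lt0n.
Qed.

Lemma r_seqP (R : realType) (n : nat) : (0 < n)%N ->
  [/\ (1 <= r_seq R n <= n)%N, alpha R n (r_seq R n) <= 5 &
      forall i, (1 <= i <= n)%N -> alpha R n i <= 5 -> (r_seq R n <= i)%N].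
Proof.
move=> n0.
have [Hr Ha] : (1 <= r_seq R n <= n)%N /\ alpha R n (r_seq R n) <= 5.
  rewrite /r_seq big_seq_cond; elim/big_ind: _ => [|x y Hx Hy|i].
  - by rewrite n0 leqnn alpha_nn // ler_nat.
  - by rewrite /minn; case: ifP.
  - by rewrite mem_index_iota ltnS => /andP[].
split=> // i /andP[i1 iN] ai; rewrite /r_seq.
have : i \in index_iota 1 n.+1 by rewrite mem_index_iota i1 ltnS.
elim: (index_iota 1 n.+1) => // a s IH; rewrite inE big_cons.
case/orP => [/eqP <-|/IH H]; first by rewrite ai geq_minl.
by case: ifP => // _; rewrite geq_min H orbT.
Qed.

(* Main.v *)
(* Comparing the harmonic sum with the logarithm gives
     2 / x - ln x <= alpha_n(i) <= 2 / x - ln x + 1 / i   for x = i / n,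
   and 2 / x - ln x = 5 is the equation f x = e^-5. As x |-> 2 / x - ln x
   decreases fast enough, r_n / n lies within 2 / n above its root r. The root
   is located by evaluating f at both ends of the claimed interval. *)
Require Import Defs.
From mathcomp Require Import all_boot all_order all_algebra.
From mathcomp Require Import all_classical all_reals all_analysis.
From mathcomp Require Import ring lra.
Import Order.TTheory GRing.Theory Num.Theory.
Import numFieldNormedType.Exports.
Local Open Scope classical_set_scope.
Local Open Scope ring_scope.

Lemma expR_ge_series (R : realType) (x : R) (n : nat) :
  0 <= x -> series (exp_coeff x) n <= expR x.
Proof.
move=> x0; apply: nondecreasing_cvgn_le; last exact: is_cvg_series_exp_coeff.
by apply/nondecreasing_seqP => k; rewrite seriesSr lerDl exp_coeff_ge0.
Qed.

(* The bounds [series (exp_coeff x) k + 2 x^k / k!] decrease in [k], since the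
   ratio of consecutive coefficients is at most 1/2. *)
Lemma expR_le_series (R : realType) (x : R) (n : nat) : (0 < n)%N ->
  0 <= x <= 1 -> expR x <= series (exp_coeff x) n + 2 * exp_coeff x n.
Proof.
case: n => // n _ /andP[x0 x1].
(* The index is shifted because the coefficient ratio [x / j.+1] is sure to be at most 1/2 only from
   [j = 1] on. *)
pose u k := series (exp_coeff x) k.+1 + 2 * exp_coeff x k.+1.
have ucvg : u @ \oo --> expR x.
  rewrite -[expR x]addr0 -[0](mulr0 2); apply: cvgD.
    by rewrite (cvg_shiftS (series (exp_coeff x))); exact: is_cvg_series_exp_coeff.
  apply: cvgM; first exact: cvg_cst.
  rewrite (cvg_shiftS (exp_coeff x)).
  exact/cvg_series_cvg_0/is_cvg_series_exp_coeff.
have udec : nonincreasing_seq u.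
  apply/nonincreasing_seqP => k; rewrite /u seriesSr -addrA lerD2l.
  suff H : 2 * exp_coeff x k.+2 <= exp_coeff x k.+1 by lra.
  have -> : exp_coeff x k.+2 = exp_coeff x k.+1 * (x / k.+2%:R).
    by rewrite /exp_coeff /= exprS factS natrM invfM; ring.
  have /ler_wpM2l H : 2 * (x / k.+2%:R) <= 1.
    by rewrite mulrA ler_pdivrMr // mul1r; have : 2 <= k.+2%:R :> R
      by [rewrite ler_nat]; lra.
  by have := H _ (exp_coeff_ge0 k.+1 x0); rewrite mulr1 mulrCA.
rewrite -(cvg_lim _ ucvg) //.
by apply: (nonincreasing_cvgn_ge udec); exact: cvgP ucvg.
Qed.

(** Both sides are [ln (1 + y) <= y], at [y = - 1 / (n + 1)] and at [y = 1 / n]. *)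
Lemma ln_succ_bounds (R : realType) (n : nat) : (0 < n)%N ->
  (n.+1%:R^-1 : R) <= ln (n.+1%:R : R) - ln n%:R <= n%:R^-1.
Proof.
move=> n0; have n0R : 0 < n%:R :> R by rewrite ltr0n.
have SnR : 0 < n.+1%:R :> R by rewrite ltr0n.
have nE : n.+1%:R = n%:R + 1 :> R by rewrite natr1.
rewrite -ln_div ?posrE //; apply/andP; split.
  rewrite -[X in ln X]invrK lnV ?posrE ?invr_gt0 ?divr_gt0 // invf_div lerNr.
  have -> : n%:R / n.+1%:R = 1 + - n.+1%:R^-1 :> R.
    by rewrite nE; field; rewrite -nE; lra.
  by apply: le_ln1Dx; rewrite ltrN2 invf_lt1 // ltr1n.
have -> : n.+1%:R / n%:R = 1 + n%:R^-1 :> R by rewrite nE; field; lra.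
by apply: le_ln1Dx; apply: lt_trans (_ : 0 < _); rewrite ?invr_gt0 //; lra.
Qed.

(** Passing from [n] to [n + 1] adds [1 / n] to the sum. The gap [1 / n - 1 / (n + 1)] between the
    two bounds of [ln_succ_bounds] telescopes to the error term. *)
Lemma harmonic_bounds (R : realType) (i n : nat) : (0 < i <= n)%N ->
  ln (n%:R : R) - ln i%:R <= \sum_(i.+1 <= j < n.+1) ((j.-1)%:R^-1 : R)
    <= ln n%:R - ln i%:R + (i%:R^-1 - n%:R^-1).
Proof.
case/andP=> i0; elim: n => [|n IH]; first by rewrite leqNgt i0.
rewrite leq_eqVlt => /predU1P[<-|lin]; first by rewrite big_geq // !subrr addr0 lexx.
rewrite big_nat_recr //=; have := IH lin.
have := @ln_succ_bounds R n (leq_trans i0 lin).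
by move: n.+1%:R^-1 => u; lra.
Qed.

Lemma alpha_bounds (R : realType) (i n : nat) : (0 < i <= n)%N ->
  2 / (i%:R / n%:R) - ln (i%:R / n%:R) <= alpha R n i
    <= 2 / (i%:R / n%:R) - ln (i%:R / n%:R) + i%:R^-1.
Proof.
move=> Hin; have /andP[i0 lin] := Hin; have n0 := leq_trans i0 lin.
have i0R : 0 < i%:R :> R by rewrite ltr0n.
have n0R : 0 < n%:R :> R by rewrite ltr0n.
have nV : 0 < n%:R^-1 :> R by rewrite invr_gt0.
rewrite /alpha ln_div ?posrE // natrM.
have -> : 2 / (i%:R / n%:R) = 2 * n%:R / i%:R :> R by rewrite invf_div mulrA.
have := @harmonic_bounds R i n Hin; lra.
Qed.

Lemma f_eq_expRN (R : realType) (r c : R) : 0 < r ->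
  f r = expR (- c) -> 2 / r - ln r = c.
Proof.
move=> r0 /(congr1 (@ln R)).
rewrite /f lnM ?posrE ?expR_gt0 // !expRK mulNr; lra.
Qed.

(** This leaves a single exponential to estimate. For [c = 5] and [x] near 0.4709 its exponent is
    about 0.753, within the range of [expR_le_series]. *)
Lemma f_lt_expRN (R : realType) (x c : R) :
  (f x < expR (- c)) = (x * expR (c - 2 / x) < 1).
Proof.
rewrite -[LHS](ltr_pM2r (expR_gt0 c)) -expRD addNr expR0 /f -mulrA.
by rewrite -(expRD (- 2 / x) c) addrC mulNr.
Qed.

Lemma f_gt_expRN (R : realType) (x c : R) :
  (expR (- c) < f x) = (1 < x * expR (c - 2 / x)).
Proof.
rewrite -[LHS](ltr_pM2r (expR_gt0 c)) -expRD addNr expR0 /f -mulrA.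
by rewrite -(expRD (- 2 / x) c) addrC mulNr.
Qed.

Lemma continuous_f (R : realType) (x : R) : 0 < x -> {for x, continuous (@f R)}.
Proof.
move=> x0; apply: cvgM; first exact: cvg_id.
apply: (@cvg_comp _ _ _ (fun y : R => - 2 / y) (@expR R)); last exact: continuous_expR.
by apply: cvgM; [exact: cvg_cst | apply: cvgV; [rewrite gt_eqF | exact: cvg_id]].
Qed.

Lemma f_lower (R : realType) : f (470 / 10 ^+ 3 + 926 / 10 ^+ 6 + 5 / 10 ^+ 7 : R) < expR (- 5).
Proof.
rewrite f_lt_expRN; set a := (X in X * _).
have a0 : 0 < a by rewrite /a; lra.
(* A short decimal just above [5 - 2 / a], which is about 0.75305277. *)
pose t : R := 753 / 10 ^+ 3 + 528 / 10 ^+ 7.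
have t01 : 0 <= t <= 1 by rewrite /t; lra.
have aT : expR (5 - 2 / a) <= expR t.
  by rewrite ler_expR lerBlDr -lerBlDl ler_pdivlMr // /t /a; lra.
apply: le_lt_trans (_ : a * expR t < 1); first by rewrite ler_pM2l.
rewrite mulrC -ltr_pdivlMr //.
apply: le_lt_trans (@expR_le_series R t 9 isT t01) _.
rewrite ltr_pdivlMr //.
rewrite /series/= !big_nat_recl // big_geq // /exp_coeff /= !factS fact0 /t /a.
rewrite !natrM.
lra.
Qed.

Lemma f_upper (R : realType) : expR (- 5) < f (470 / 10 ^+ 3 + 927 / 10 ^+ 6 + 5 / 10 ^+ 7 : R).
Proof.
rewrite f_gt_expRN; set b := (X in X * _).
have b0 : 0 < b by rewrite /b; lra.
(* A short decimal just below [5 - 2 / b], which is about 0.75306178. *)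
pose t : R := 753 / 10 ^+ 3 + 61 / 10 ^+ 6.
have t0 : 0 <= t by rewrite /t; lra.
have tb : expR t <= expR (5 - 2 / b).
  by rewrite ler_expR lerBrDr -lerBrDl ler_pdivrMr // /t /b; lra.
apply: lt_le_trans (_ : b * expR t <= _); last by rewrite ler_pM2l.
rewrite mulrC -ltr_pdivrMr //.
apply: lt_le_trans (@expR_ge_series R t 8 t0).
rewrite ltr_pdivrMr //.
rewrite /series/= !big_nat_recl // big_geq // /exp_coeff /= !factS fact0 /t /b.
rewrite !natrM; lra.
Qed.

(* For [r <= x <= 1], [2 / x - ln x] is at most [5 - 2 (x - r) / r], so the gap
   beats the error [1 / i <= 1 / (r n)] once [x = i / n >= r + 1 / (2 n)]. *)
Lemma r_seq_bounds (R : realType) (r : R) (n : nat) : (0 < n)%N ->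
  0 < r -> 2 / r - ln r = 5 ->
  r <= (r_seq R n)%:R / n%:R <= r + 2 / n%:R.
Proof.
move=> n0 r0 rE; have n0R : 0 < n%:R :> R by rewrite ltr0n.
have [rn1 arn rmin] := r_seqP R n0.
apply/andP; split.
  (* Below [r], the strictly decreasing [2 / x - ln x] exceeds 5, and so does [alpha]. *)
  rewrite leNgt; apply/negP => xr.
  have /andP[lo _] := @alpha_bounds R (r_seq R n) n rn1.
  set x := _ / _ in xr lo.
  have x0 : 0 < x by rewrite divr_gt0 // ltr0n; case/andP: rn1.
  have lnx : ln x < ln r by rewrite ltr_ln.
  have : r^-1 < x^-1 by rewrite ltf_pV2.
  lra.
have rn0 : 0 <= r * n%:R by rewrite mulr_ge0 ?ltW.
(* The offset 2 gives [r n + 1 < i <= r n + 2]: the left part makes [x - r] at least [1 / n], the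
   right part yields the final bound. *)
pose i := (Num.truncn (r * n%:R)).+2.
have /andP[ilo ihi] := truncn_itv rn0.
have iE : i%:R = (Num.truncn (r * n%:R)).+1%:R + 1 :> R by rewrite /i natr1.
have iE' : i%:R = (Num.truncn (r * n%:R))%:R + 2 :> R by rewrite /i -addn2 natrD.
suff ri : (r_seq R n <= i)%N.
  rewrite ler_pdivrMr // mulrDl divfK ?gt_eqF //.
  apply: le_trans (_ : i%:R <= _); first by rewrite ler_nat.
  by rewrite iE' lerD2r.
case: (leqP i n) => [lin|/ltnW/(leq_trans _)]; last by apply; case/andP: rn1.
have iin : (0 < i <= n)%N by rewrite lin.
apply: rmin => //.
have /andP[_ hi] := @alpha_bounds R i n iin.
apply: le_trans hi _; set x : R := i%:R / n%:R.
have i0R : 0 < i%:R :> R by rewrite ltr0n.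
have x0 : 0 < x by rewrite divr_gt0.
have iX : i%:R = x * n%:R by rewrite /x divfK ?gt_eqF.
have x1 : x <= 1 by rewrite /x ler_pdivrMr // mul1r ler_nat.
have gap : 1 <= (x - r) * n%:R by rewrite mulrBl -iX; lra.
have rx : r < x by rewrite -(ltr_pM2r n0R); lra.
have lnx : ln r <= ln x by rewrite ler_ln ?posrE // ltW.
(* The logarithm only helps here, so the drop of [2 / x] alone has to absorb the error [1 / i]. *)
suff : i%:R^-1 <= 2 / r - 2 / x by lra.
have -> : 2 / r - 2 / x = 2 * (x - r) / (r * x) by field; lra.
have rx0 : 0 < r * x by rewrite mulr_gt0.
rewrite ler_pdivlMr // [_ * (r * x)]mulrC ler_pdivrMr // iX.
have : x * 1 <= x * ((x - r) * n%:R) by rewrite ler_pM2l.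
have : r * x <= 2 * x by rewrite ler_pM2r //; lra.
lra.
Qed.

Theorem theorem2p2 (R : realType) :
  exists r : R,
    [/\ ((r_seq R n)%:R / n%:R : R) @[n --> \oo] --> r,
        0 < r,
        f r = expR (- 5) &
        `|r - (470 / 10 ^+ 3 + 927 / 10 ^+ 6)| < 5 / 10 ^+ 7].
Proof.
(* [a] and [b] are 0.470927 minus and plus half a unit of the sixth decimal. *)
set a : R := 470 / 10 ^+ 3 + 926 / 10 ^+ 6 + 5 / 10 ^+ 7.
set b : R := 470 / 10 ^+ 3 + 927 / 10 ^+ 6 + 5 / 10 ^+ 7.
have ab : a <= b by rewrite /a /b; lra.
have a0 : 0 < a by rewrite /a; lra.
have fa : f a < expR (- 5) := f_lower R.
have fb : expR (- 5) < f b := f_upper R.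
have [||r] := @IVT R (@f R) a b (expR (- 5)) ab.
- apply: continuous_in_subspaceT => x; rewrite inE /= in_itv /= => /andP[ax _].
  by apply: continuous_f; exact: lt_le_trans ax.
- by rewrite ge_min le_max (ltW fa) (ltW fb) orbT.
rewrite in_itv /= => /andP[ar rb] fr.
have r0 : 0 < r := lt_le_trans a0 ar.
(* The root comes from a closed interval; the strict values of [f] at [a] and [b] exclude both
   ends. *)
have {}ar : a < r by rewrite lt_neqAle ar andbT; apply: contraTneq fa => ->; rewrite fr ltxx.
have {}rb : r < b by rewrite lt_neqAle rb andbT; apply: contraTneq fb => <-; rewrite fr ltxx.
exists r; split=> //; last first.
  by rewrite ltr_norml; apply/andP; split; move: ar rb; rewrite /a /b; lra.
have rE := f_eq_expRN R r 5 r0 fr.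
apply: (@squeeze_cvgr _ _ _ _ (fun=> r) (fun n => r + 2 / n%:R)).
- by near=> n; apply: r_seq_bounds => //; near: n; exists 1%N.
- exact: cvg_cst.
- rewrite -[X in _ --> X]addr0 -[X in _ + X](mulr0 2); apply: cvgD; first exact: cvg_cst.
  apply: cvgM; first exact: cvg_cst.
  by apply/gtr0_cvgV0; [near=> n; rewrite ltr0n; near: n; exists 1%N | exact: cvgr_idn].
Unshelve. all: by end_near. Qed.
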